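(* Let $m\geq 1$ and $l\geq 0$ be integers. Then for all real $x$ with $0<|x|<1$, $${}_2F_1(1,m;m+l+1;x)=\frac{(m)_{l+1}}{x^{m+l}}\frac{(-1)^{l+1}}{l!}(1-x)^l\log(1-x)+\frac{m+l}{x^{m+l}}\sum_{\substack{i=0\\ i\neq m-1}}^{m+l-1}\binom{m+l-1}{i}\frac{(-1)^{m+l-1-i}}{i-m+1}\left((1-x)^{m+l-1-i}-(1-x)^l\right),$$ and also $${}_2F_1(1,m;m+l+1;x)=\frac{(m)_{l+1}}{x^{m+l}}\frac{(-1)^{l+1}}{l!}(1-x)^l\log(1-x)+\frac{(m)_{l+1}}{x^{m+l}}\left\{\frac{(-1)^{l+1}}{l!}\sum_{j=1}^{l}x^j\sum_{i=0}^{j-1}\frac{(-1)^i}{j-i}\binom{l}{i}-\sum_{i=0}^{m-2}\frac{x^{l+i+1}}{(i+1)_{l+1}}\right\}.$$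
   Context: $(r)_0:=1$ and $(r)_j:=r(r+1)\cdots(r+j-1)$ for $j\ge 1$. The hypergeometric function is ${}_2F_1(a,b;c;x)=\sum_{j=0}^\infty \frac{(a)_j(b)_j}{(c)_j\,j!}x^j$ for $|x|<1$. Empty sums are $0$. *)

(* Defs.v *)
From mathcomp Require Import all_boot all_order all_algebra.
From mathcomp Require Import all_classical all_reals all_analysis.
From mathcomp Require Import ring lra.

Set Implicit Arguments.
Unset Strict Implicit.
Unset Printing Implicit Defensive.

Import Order.TTheory GRing.Theory Num.Theory.
Import numFieldNormedType.Exports.

Local Open Scope classical_set_scope.
Local Open Scope ring_scope.

Definition pochhammer (R : pzRingType) (r : R) (j : nat) : R :=
  \prod_(0 <= k < j) (r + k%:R).

Definition hyp2F1_coef (R : realType) (a b c : R) (j : nat) : R :=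
  pochhammer a j * pochhammer b j / (pochhammer c j * j`!%:R).

(* [limn] is total; [is_cvg_hyp2F1] below shows that on the unit disc the
   series does converge, so that this is its actual sum there. *)
Definition hyp2F1 (R : realType) (a b c x : R) : R :=
  limn (pseries (hyp2F1_coef a b c) x).

Lemma pochhammerS (R : pzRingType) (r : R) (j : nat) :
  pochhammer r j.+1 = pochhammer r j * (r + j%:R).
Proof. by rewrite /pochhammer big_nat_recr. Qed.

Lemma hyp2F1_coefS (R : realType) (a b c : R) (j : nat) :
  c + j%:R != 0 ->
  hyp2F1_coef a b c j.+1 =
  (a + j%:R) / (c + j%:R) * ((b + j%:R) / j.+1%:R) * hyp2F1_coef a b c j.
Proof.
move=> cj; rewrite /hyp2F1_coef !pochhammerS factS natrM !invfM.
by ring.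
Qed.

Lemma cvg_ratio1 (R : realType) (a c : R) :
  (forall k : nat, c + k%:R != 0) ->
  (a + n%:R) / (c + n%:R) @[n --> \oo] --> (1 : R).
Proof.
move=> c0.
have -> : (fun n : nat => (a + n%:R) / (c + n%:R)) =
          (fun n : nat => 1 + (a - c) * (c + n%:R)^-1).
  apply/funext => n; apply: (mulIf (c0 n)).
  rewrite mulfVK ?c0 // mulrDl -mulrA mulVf ?c0 //; ring.
rewrite -[X in _ --> X]addr0 -[X in _ --> _ + X](mulr0 (a - c)).
apply: cvgD; first exact: cvg_cst.
apply: cvgMl_tmp.
apply/gtr0_cvgV0.
  near=> n.
  rewrite -ltrBlDl sub0r.
  by near: n; exact: nbhs_infty_gtr.
apply/cvgryPge => A.
near=> n.
rewrite -lerBlDl.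
by near: n; exact: nbhs_infty_ger.
Unshelve. all: by end_near. Qed.

Lemma is_cvg_hyp2F1 (R : realType) (a b c x : R) :
  (forall k : nat, c + k%:R != 0) -> `|x| < 1 ->
  cvgn (pseries (hyp2F1_coef a b c) x).
Proof.
move=> c0 x1.
pose q n := (a + n%:R) / (c + n%:R) * ((b + n%:R) / (1 + n%:R)).
pose t n := hyp2F1_coef a b c n * x ^+ n.
have tS n : t n.+1 = q n * x * t n.
  by rewrite /t hyp2F1_coefS // exprS /q [1 + _]addrC natr1; ring.
have qx : `|q n * x| @[n --> \oo] --> `|x|.
  suff : q n * x @[n --> \oo] --> 1 * 1 * x by rewrite !mul1r => /cvg_norm.
  apply: cvgMr_tmp; apply: cvgM; exact: cvg_ratio1.
pose r := (`|x| + 1) / 2.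
have xr : `|x| < r by rewrite /r; lra.
have r1 : r < 1 by rewrite /r; lra.
have r0 : 0 < r by rewrite /r; have := normr_ge0 x; lra.
have [N _ qN] := @cvgr_lt _ _ _ _ _ _ qx _ xr.
pose C := \sum_(0 <= k < N.+1) `|t k| / r ^+ k.
have C0 n : (n <= N)%N -> `|t n| <= geometric C r n.
  move=> nN; rewrite /geometric /= -ler_pdivrMr ?exprn_gt0 // /C big_mkord.
  rewrite (bigD1 (Ordinal (nN : (n < N.+1)%N))) //= lerDl.
  by apply: sumr_ge0 => k _; rewrite divr_ge0 // exprn_ge0 // ltW.
have bnd n : `|t n| <= geometric C r n.
  elim: n => [|n IH]; first exact: C0.
  have [|Nn] := leqP n.+1 N; first exact: C0.
  rewrite tS normrM /geometric /= exprS mulrCA.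
  by apply: ler_pM => //; apply/ltW/qN.
apply: normed_cvg.
apply: (series_le_cvg _ _ bnd) => // [n|]; first exact: le_trans (bnd n).
by apply: is_cvg_geometric_series; rewrite ger0_norm // ltW.
Qed.

(* Main.v *)
Require Import Defs.
From mathcomp Require Import all_boot all_order all_algebra.
From mathcomp Require Import all_classical all_reals all_analysis.
From mathcomp Require Import ring lra zify.

Import Order.TTheory GRing.Theory Num.Theory.
Import numFieldNormedType.Exports.

Local Open Scope ring_scope.

(* The coefficients of the hypergeometric series are, up to a constant factor,
   those of [- (1 - x) ^+ l * ln (1 - x)] from degree [m + l] on (partial
   fractions of [1 / (k)_(l+1)]), so [x ^ (m + l) * 2F1] is a multiple of that
   logarithmic function minus its Taylor polynomial of degree [m + l - 1].
   Splitting this polynomial at degree [l] gives the second formula.  The sum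
   in the first formula is the same polynomial, because both vanish at [0] and
   solve the same first-order linear differential equation. *)

(** * Pochhammer symbols and partial fractions *)

Lemma pochhammer_recl (R : pzRingType) (r : R) (j : nat) :
  pochhammer r j.+1 = r * pochhammer (r + 1) j.
Proof.
rewrite /pochhammer big_nat_recl // addr0; congr (_ * _).
by apply: eq_bigr => k _; rewrite -addrA nat1r.
Qed.

Lemma pochhammerD (R : pzRingType) (r : R) (i j : nat) :
  pochhammer r (i + j) = pochhammer r i * pochhammer (r + i%:R) j.
Proof.
elim: j => [|j IH]; first by rewrite addn0 [X in _ * X]/pochhammer big_nil mulr1.
by rewrite addnS !pochhammerS IH mulrA natrD addrA.
Qed.

Lemma pochhammer_gt0 (R : numDomainType) (r : R) (j : nat) :
  0 < r -> 0 < pochhammer r j.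
Proof.
by move=> r0; apply: prodr_gt0 => k _; rewrite ltr_wpDr.
Qed.

Lemma pochhammer1 (R : pzRingType) (j : nat) :
  pochhammer 1 j = j`!%:R :> R.
Proof.
elim: j => [|j IH]; first by rewrite /pochhammer big_nil.
by rewrite pochhammerS IH nat1r factS mulnC natrM.
Qed.

(** Pascal's rule: an alternating binomial sum is an iterated finite difference, so one more order
    means applying the previous one to [f i - f i.+1]. *)
Lemma signed_binomial_sumS (R : pzRingType) (l : nat) (f : nat -> R) :
  \sum_(0 <= i < l.+2) (-1) ^+ i * 'C(l.+1, i)%:R * f i =
  \sum_(0 <= i < l.+1) (-1) ^+ i * 'C(l, i)%:R * (f i - f i.+1).
Proof.
under [RHS]eq_bigr do rewrite mulrBr.
rewrite sumrB big_nat_recl // [X in _ = X - _]big_nat_recl //.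
rewrite !bin0 -addrA; congr (_ + _).
under eq_bigr do rewrite binS natrD mulrDr mulrDl.
rewrite big_split big_nat_recr //= bin_small // mulr0 mul0r addr0.
congr (_ + _); rewrite -sumrN; apply: eq_bigr => i _.
by rewrite exprS !mulN1r !mulNr.
Qed.

(** Induction on [l] for all [r] at once, through 1/(r)_(l+1) - 1/(r+1)_(l+1) = (l+1)/(r)_(l+2). *)
Lemma inv_pochhammer_partial_fraction (R : numFieldType) (l : nat) (r : R) :
  0 < r ->
  (pochhammer r l.+1)^-1 =
    l`!%:R^-1 * \sum_(0 <= i < l.+1) (-1) ^+ i * 'C(l, i)%:R / (r + i%:R).
Proof.
elim: l r => [|l IH] r r0.
  by rewrite /pochhammer !big_nat1 bin0 expr0 addr0 !mul1r invr1 mul1r.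
have r10 : 0 < r + 1 by rewrite ltr_wpDr.
have rl0 : 0 < r + 1 + l%:R by rewrite ltr_wpDr.
have P0 := pochhammer_gt0 _ _ l r10.
have l0 : 0 < l.+1%:R :> R by rewrite ltr0n.
transitivity (((pochhammer r l.+1)^-1 - (pochhammer (r + 1) l.+1)^-1) / l.+1%:R).
  rewrite [pochhammer r l.+2]pochhammer_recl [pochhammer r l.+1]pochhammer_recl.
  rewrite pochhammerS -natr1.
  by field; rewrite natr1 !gt_eqF //.
rewrite !IH // factS natrM invfM -mulrBr mulrAC [X in X * _ = _]mulrC.
congr (_ * _).
rewrite (signed_binomial_sumS R l (fun i => (r + i%:R)^-1)) -sumrB.
by apply: eq_bigr => i _; rewrite mulrBr -addrA nat1r.
Qed.

(** * The logarithmic series *)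

(** The derivative of the sum is a geometric sum, which cancels all of -1/(1-t) but its tail. The
    term [k = 0] vanishes because [0^-1 = 0]. *)
Lemma is_derive_log_remainder (R : realType) (n : nat) (t : R) : t < 1 ->
  is_derive t 1 (fun t => ln (1 - t) + \sum_(0 <= k < n.+1) t ^+ k / k%:R)
    (- (t ^+ n / (1 - t))).
Proof.
move=> t1; have u0 : 0 < 1 - t by rewrite subr_gt0.
have dln : is_derive t 1 (fun t => ln (1 - t)) (- (1 - t)^-1).
  have dl := is_derive1_ln u0.
  have d1 : is_derive t 1 (fun t : R => 1 - t) (- 1).
    by apply: is_derive_eq; rewrite add0r mul1r.
  have := @is_derive1_comp R (@ln R) (fun t : R => 1 - t) t _ _ dl d1.
  by rewrite mulrN1.
elim: n => [|n IH].
  under eq_fun do rewrite big_nat1 invr0 mulr0 addr0.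
  by rewrite expr0 mul1r.
under eq_fun do rewrite big_nat_recr //= addrA.
have dX : is_derive t 1 (fun t : R => t ^+ n.+1 / n.+1%:R) (t ^+ n).
  have -> : (fun t : R => t ^+ n.+1 / n.+1%:R) = n.+1%:R^-1 \*: (id ^+ n.+1).
    by apply/funext => y; rewrite /= fctE mulrC.
  apply: is_derive_eq.
  by rewrite /= /GRing.scale /= mulr1 mulrA mulVf ?mul1r // pnatr_eq0.
have -> : - (t ^+ n.+1 / (1 - t)) = - (t ^+ n / (1 - t)) + t ^+ n.
  by rewrite exprS; field; rewrite gt_eqF.
exact: is_deriveD IH dX.
Qed.

(** The mean value theorem between 0 and [x] turns the derivative of the remainder into a bound that
    tends to 0 geometrically. *)
Lemma cvg_log_series (R : realType) (x : R) : `|x| < 1 ->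
  (\sum_(0 <= k < n) x ^+ k / k%:R @[n --> \oo] --> - ln (1 - x))%classic.
Proof.
move=> x1; have [xm xM] : -1 < x /\ x < 1 by apply/andP; rewrite -ltr_norml.
pose f n t : R := ln (1 - t) + \sum_(0 <= k < n.+1) t ^+ k / k%:R.
have f0 n : f n 0 = 0.
  rewrite /f subr0 ln1 add0r big_nat_recl // invr0 mulr0 add0r big1 // => k _.
  by rewrite exprS mul0r mul0r.
have bnd n : `|f n x| <= `|x| ^+ n / (1 - `|x|).
  (* Uses 1 - c >= 1 - |x| for the denominator, and bounds the last factor |x| by 1. *)
  have key c : `|c| <= `|x| -> `|- (c ^+ n / (1 - c)) * x| <= `|x| ^+ n / (1 - `|x|).
    move=> cx; rewrite normrM normrN normrM normfV normrX.
    have c1 : c <= `|x| by rewrite (le_trans _ cx) // ler_norm.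
    rewrite (ger0_norm (_ : 0 <= 1 - c)); last by lra.
    apply: (@le_trans _ _ (`|x| ^+ n / (1 - `|x|) * 1)); last by rewrite mulr1.
    apply: ler_pM => //; last exact: ltW.
      by rewrite divr_ge0 ?exprn_ge0 //; lra.
    apply: ler_pM; rewrite ?exprn_ge0 // ?invr_ge0; first by lra.
      by rewrite lerXn2r // nnegrE.
    by rewrite lef_pV2 ?posrE; lra.
  have cont a b : b < 1 -> {within `[a, b], continuous (f n)}%classic.
    move=> b1; apply: derivable_within_continuous => t.
    rewrite in_itv /= => /andP[_ tb]; have t1 : t < 1 by lra.
    by have [] := is_derive_log_remainder _ n _ t1.
  have mvt a b : a <= b -> b < 1 ->
      exists2 c, c \in `[a, b] & f n b - f n a = - (c ^+ n / (1 - c)) * (b - a).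
    move=> ab b1; apply: (@MVT_segment R (f n) (fun c => - (c ^+ n / (1 - c)))) => //.
      move=> t; rewrite in_itv /= => /andP[_ tb].
      by apply: is_derive_log_remainder; lra.
    exact: cont.
  (* The mean value theorem needs ordered endpoints, hence the split on the sign of [x]. *)
  have [x0|x0] := leP 0 x.
    have [c] := mvt 0 x x0 xM.
    rewrite f0 !subr0 in_itv /= => /andP[c0 cx] ->; apply: key.
    by rewrite !ger0_norm.
  have [c] := mvt x 0 (ltW x0) ltr01.
  rewrite f0 !sub0r in_itv /= => /andP[cx c0] /(congr1 -%R).
  rewrite opprK mulrN opprK => ->.
  by apply: key; rewrite !ler0_norm ?lerN2 // ltW.
rewrite -(cvg_shiftn 1) /=.
under eq_fun do rewrite addn1.
apply/cvgrPdist_le => e e0.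
have : (`|x| ^+ n / (1 - `|x|) @[n --> \oo] --> (0 : R))%classic.
  rewrite -[X in (_ --> X)%classic](mul0r (1 - `|x|)^-1).
  by apply: cvgMr_tmp; apply: cvg_expr; rewrite normr_id.
move=> /cvgr0Pnorm_le /(_ e e0); apply: filterS => n.
rewrite ger0_norm ?divr_ge0 ?exprn_ge0 //; last by lra.
move=> le_e; rewrite -normrN; apply: le_trans le_e.
by rewrite opprB opprK addrC; exact: bnd.
Qed.

(** * The power series of -(1-x)^l ln(1-x) *)

(* The coefficients of the power series of [- (1 - x) ^+ l * ln (1 - x)]. *)
Definition powlog_coef (R : unitRingType) (l p : nat) : R :=
  \sum_(0 <= i < p) (-1) ^+ i / (p%:R - i%:R) * 'C(l, i)%:R.

(** For [p > l] the sum runs over every nonzero ['C(l, i)]; reversing [i] to [l - i] gives the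
    partial fractions at [r = p - l]. *)
Lemma powlog_coef_gt (R : numFieldType) (l p : nat) : (l < p)%N ->
  powlog_coef R l p = (-1) ^+ l * l`!%:R / pochhammer (p - l)%:R l.+1.
Proof.
move=> lp; rewrite inv_pochhammer_partial_fraction; last by rewrite ltr0n subn_gt0.
rewrite -mulrA mulVKf ?pnatr_eq0 -?lt0n ?fact_gt0 //.
rewrite /powlog_coef (big_cat_nat _ (n := l.+1)) //= [X in _ + X]big_nat
  [X in _ + X]big1 ?addr0.
  rewrite [in RHS]big_nat_rev /= mulr_sumr [LHS]big_nat [RHS]big_nat.
  apply: eq_bigr => i /andP[_ il].
  rewrite add0n subSS bin_sub // !natrB ?(ltnW lp) //.
  have -> : p%:R - l%:R + (l%:R - i%:R) = p%:R - i%:R :> R by ring.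
  have -> : (-1) ^+ i = (-1) ^+ l * (-1) ^+ (l - i) :> R.
    by rewrite -exprD -[RHS]signr_odd oddD oddB // addKb signr_odd.
  by ring.
by move=> i /andP[li _]; rewrite bin_small // mulr0.
Qed.

(** The coefficient of x^p in (1-x) y' + l y = (1-x)^l, the equation solved by y = -(1-x)^l
    ln(1-x). *)
Lemma powlog_coefS (R : numFieldType) (l p : nat) :
  p.+1%:R * powlog_coef R l p.+1 + (l%:R - p%:R) * powlog_coef R l p =
  (-1) ^+ p * 'C(l, p)%:R.
Proof.
pose c i : R := (-1) ^+ i * 'C(l, i)%:R.
have cS i : i.+1%:R * c i.+1 = - (l%:R - i%:R) * c i.
  rewrite /c exprS mulrCA -natrM mul_bin_left natrM.
  have [il|li] := leqP i l; first by rewrite natrB //; ring.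
  by rewrite bin_small //; ring.
(* Write (p+1)/(p+1-i) = 1 + i/(p+1-i) and shift the index by [cS]. In [e2], (l-p)/(p-i) =
   (l-i)/(p-i) - 1 yields the same correction sum with opposite sign, so only [c p] survives. *)
have e1 : p.+1%:R * powlog_coef R l p.+1 =
    \sum_(0 <= i < p.+1) c i - \sum_(0 <= i < p) (l%:R - i%:R) * c i / (p%:R - i%:R).
  have -> : \sum_(0 <= i < p) (l%:R - i%:R) * c i / (p%:R - i%:R) =
      - \sum_(0 <= i < p.+1) i%:R * c i / (p.+1%:R - i%:R).
    rewrite [in RHS]big_nat_recl // !mul0r add0r -sumrN; apply: eq_bigr => i _.
    rewrite cS.
    have -> : p.+1%:R - i.+1%:R = p%:R - i%:R :> R by rewrite -!natr1; ring.
    by rewrite !mulNr opprK.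
  rewrite opprK -big_split mulr_sumr [LHS]big_nat [RHS]big_nat.
  apply: eq_bigr => i /andP[_ ip].
  have : 1 + p%:R - i%:R != 0 :> R by rewrite nat1r subr_eq0 eqr_nat; lia.
  by move=> ? /=; rewrite /c; field.
have e2 : (l%:R - p%:R) * powlog_coef R l p =
    - \sum_(0 <= i < p) c i + \sum_(0 <= i < p) (l%:R - i%:R) * c i / (p%:R - i%:R).
  rewrite -sumrN -big_split mulr_sumr [LHS]big_nat [RHS]big_nat.
  apply: eq_bigr => i /andP[_ ip].
  have : p%:R - i%:R != 0 :> R by rewrite subr_eq0 eqr_nat; lia.
  by move=> ? /=; rewrite /c; field.
by rewrite e1 e2 big_nat_recr //= /c; ring.
Qed.

Lemma shifted_log_sum (R : fieldType) (x : R) (i n : nat) :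
  \sum_(0 <= p < n) (if (i <= p)%N then x ^+ p / (p - i)%:R else 0) =
  x ^+ i * \sum_(0 <= k < n - i) x ^+ k / k%:R.
Proof.
elim: n => [|n IH]; first by rewrite sub0n !big_nil mulr0.
rewrite big_nat_recr //= IH; case: leqP => ni.
  by rewrite subSn // big_nat_recr //= mulrDr mulrA -exprD subnKC.
by rewrite addr0 (_ : n.+1 - i = n - i)%N //; lia.
Qed.

(** Expanding (1-x)^l makes each partial sum a fixed finite combination of shifted partial sums of
    the logarithmic series, so the limit passes through termwise. *)
Lemma cvg_powlog_series (R : realType) (l : nat) (x : R) : `|x| < 1 ->
  (\sum_(0 <= p < n) powlog_coef R l p * x ^+ p @[n --> \oo] -->
   - (1 - x) ^+ l * ln (1 - x))%classic.
Proof.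
move=> x1.
pose c i : R := (-1) ^+ i * 'C(l, i)%:R.
have sumE n : \sum_(0 <= p < n) powlog_coef R l p * x ^+ p =
    \sum_(0 <= i < l.+1) c i * (x ^+ i * \sum_(0 <= k < n - i) x ^+ k / k%:R).
  under [RHS]eq_bigr do rewrite -shifted_log_sum mulr_sumr.
  rewrite exchange_big /=; apply: eq_bigr => p _.
  rewrite /powlog_coef mulr_suml.
  (* The range up to [p + l.+1] contains both [i < p] and [i < l.+1]. Extra terms vanish:
     ['C(l, i) = 0] past [l], and [i = p] gives a division by 0, which is 0. *)
  transitivity (\sum_(0 <= i < p + l.+1 | (i < p)%N) c i * (x ^+ p / (p - i)%:R)).
    rewrite [LHS](big_nat_widen _ _ (p + l.+1)) ?leq_addr //.
    by apply: eq_bigr => i /= ip; rewrite /c natrB 1?ltnW //; ring.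
  rewrite big_mkcond (big_cat_nat _ (n := l.+1)) ?leq_addl //= [X in _ + X]big_nat
  [X in _ + X]big1 ?addr0.
    apply: eq_bigr => i _; case: ltngtP => // [|->]; first by rewrite mulr0.
    by rewrite subnn invr0 !mulr0.
  by move=> i /andP[li _]; rewrite /c bin_small // mulr0 mul0r if_same.
under eq_fun do rewrite sumE.
have -> : - (1 - x) ^+ l * ln (1 - x) =
    \sum_(0 <= i < l.+1) c i * (x ^+ i * - ln (1 - x)).
  rewrite exprBn big_mkord mulNr -mulrN mulr_suml; apply: eq_bigr => i _.
  by rewrite expr1n mulr1 -mulr_natr /c; ring.
apply: cvg_big => [|i _]; first exact: add_continuous.
apply: cvgMl_tmp; apply: cvgMl_tmp.
rewrite -(cvg_shiftn i) /=.
under eq_fun do rewrite addnK.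
exact: cvg_log_series.
Qed.

(** * The hypergeometric series as a logarithmic tail *)

Lemma hyp2F1_coef_powlog (R : realType) (m l j : nat) : (0 < m)%N ->
  hyp2F1_coef 1 m%:R (m + l + 1)%:R j =
  pochhammer m%:R l.+1 * ((-1) ^+ l / l`!%:R) * powlog_coef R l (m + l + j).
Proof.
move=> m0; have m0R : 0 < m%:R :> R by rewrite ltr0n.
have fact_neq0 k : k`!%:R != 0 :> R by rewrite pnatr_eq0 -lt0n fact_gt0.
have P0 : pochhammer (m + l + 1)%:R j != 0 :> R.
  by rewrite gt_eqF // pochhammer_gt0 // ltr0n; lia.
have Q0 : pochhammer (m + j)%:R l.+1 != 0 :> R.
  by rewrite gt_eqF // pochhammer_gt0 // ltr0n; lia.
(* Both products equal (m)_(j+l+1), split after [j] or after [l.+1] factors. *)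
have key : pochhammer m%:R j * pochhammer (m + j)%:R l.+1 =
    pochhammer m%:R l.+1 * pochhammer (m + l + 1)%:R j :> R.
  have := pochhammerD R m%:R j l.+1; rewrite addnC pochhammerD -!natrD => <-.
  by rewrite -addnA addn1.
rewrite powlog_coef_gt; last by lia.
rewrite (_ : m + l + j - l = m + j)%N; last by lia.
rewrite /hyp2F1_coef pochhammer1.
have s2 : (-1) ^+ l * (-1) ^+ l = 1 :> R by rewrite -exprD addnn -signr_odd odd_double.
apply: (@mulIf _ (pochhammer (m + l + 1)%:R j * pochhammer (m + j)%:R l.+1)).
  by rewrite mulf_neq0.
transitivity (pochhammer m%:R j * pochhammer (m + j)%:R l.+1 : R).
  by field; rewrite !fact_neq0 P0.
rewrite key -[LHS](mul1r _) -[X in X * _ = _]s2.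
by field; rewrite Q0 fact_neq0.
Qed.

Lemma hyp2F1_powlog (R : realType) (m l : nat) (x : R) :
  (0 < m)%N -> 0 < `|x| -> `|x| < 1 ->
  hyp2F1 1 m%:R (m + l + 1)%:R x =
  pochhammer m%:R l.+1 / x ^+ (m + l) * ((-1) ^+ l.+1 / l`!%:R) *
  ((1 - x) ^+ l * ln (1 - x) + \sum_(0 <= p < m + l) powlog_coef R l p * x ^+ p).
Proof.
move=> m0; rewrite normr_gt0 => x0 x1.
apply/cvg_lim => //.
set K := _ * (_ / _); set S := \sum_(_ <= _ < _) _.
have -> : K * ((1 - x) ^+ l * ln (1 - x) + S) =
    - K * (- (1 - x) ^+ l * ln (1 - x) - S) by ring.
(* A partial sum of the hypergeometric series is a partial sum of the logarithmic one without its
   first [m + l] terms, divided by x^(m+l) and rescaled. *)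
have E n : pseries (hyp2F1_coef 1 m%:R (m + l + 1)%:R) x n =
    - K * (\sum_(0 <= p < n + (m + l)) powlog_coef R l p * x ^+ p - S).
  rewrite /pseries /series /= [X in X - S](big_cat_nat _ (n := m + l)) ?leq_addl //=.
  rewrite addrAC subrr add0r -{2}[(m + l)%N]add0n big_addn addnK mulr_sumr.
  apply: eq_bigr => k _; rewrite hyp2F1_coef_powlog // /K [(k + _)%N]addnC !exprD exprS.
  by field; rewrite !expf_neq0 // pnatr_eq0 -lt0n fact_gt0.
rewrite (funext E).
apply: cvgMl_tmp; apply: cvgB; last exact: cvg_cst.
rewrite (cvg_shiftn (m + l) (fun n => \sum_(0 <= p < n) powlog_coef R l p * x ^+ p)).
exact: cvg_powlog_series.
Qed.

(** * The Taylor polynomial through a differential equation *)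

Lemma pochhammer_nat (R : numDomainType) (m l : nat) :
  pochhammer m.+1%:R l.+1 = ((m + l).+1 * 'C(m + l, l) * l`!)%:R :> R.
Proof.
have f0 : m`!%:R != 0 :> R by rewrite pnatr_eq0 -lt0n fact_gt0.
apply: (mulfI f0); rewrite -pochhammer1 -nat1r -pochhammerD pochhammer1.
rewrite pochhammer1 -natrM addnS factS -(bin_fact (leq_addl m l)) addnK.
by congr (_%:R); ring.
Qed.

Lemma coef_exp_1subX (R : comNzRingType) (l n : nat) :
  ((1 - 'X : {poly R}) ^+ l)`_n = (-1) ^+ n * 'C(l, n)%:R.
Proof.
elim: l n => [|l IH] [|n].
- by rewrite coef1 mul1r.
- by rewrite coef1 mulr0.
- by rewrite exprS mulrBl mul1r coefB coefXM IH subr0 !bin0.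
- by rewrite exprS mulrBl mul1r coefB coefXM !IH binS natrD exprS /=; ring.
Qed.

Lemma coef_powlog_ode (R : comNzRingType) (a : R) (p : {poly R}) (n : nat) :
  ((1 - 'X) * p^`() + a *: p)`_n = n.+1%:R * p`_n.+1 + (a - n%:R) * p`_n.
Proof.
rewrite mulrBl mul1r coefD coefB coefXM coefZ !coef_deriv.
by case: n => [|n] /=; ring.
Qed.

(** The equation is a recurrence giving (n+1) p_(n+1) as a multiple of p_n, so a zero constant term
    propagates. *)
Lemma powlog_ode_eq0 (R : numDomainType) (a : R) (p : {poly R}) :
  (1 - 'X) * p^`() + a *: p = 0 -> p`_0 = 0 -> p = 0.
Proof.
move=> ode p0; apply/polyP => n; rewrite coef0.
elim: n => [//|n IH]; move/(congr1 (fun q : {poly R} => q`_n)): ode.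
rewrite coef_powlog_ode coef0 IH mulr0 addr0 => /eqP.
by rewrite mulf_eq0 pnatr_eq0 /= => /eqP.
Qed.

(* Both sides, as polynomials in [x], vanish at [0] and solve
   [(1 - x) y' + l y = x ^ N - 'C(N, l) (-1) ^ l (1 - x) ^ l]. *)
Lemma sum_powlog_coef (R : numFieldType) (N l : nat) (x : R) : (l <= N)%N ->
  (-1) ^+ l.+1 * 'C(N, l)%:R * \sum_(0 <= p < N.+1) powlog_coef R l p * x ^+ p =
  \sum_(0 <= k < N.+1 | k != l)
     'C(N, k)%:R * (-1) ^+ k / (l%:R - k%:R) * ((1 - x) ^+ k - (1 - x) ^+ l).
Proof.
move=> lN; pose u : {poly R} := 1 - 'X.
pose D (p : {poly R}) := u * p^`() + l%:R *: p.
pose Q : {poly R} := ((-1) ^+ l.+1 * 'C(N, l)%:R) *: \poly_(p < N.+1) powlog_coef R l p.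
pose P : {poly R} := \sum_(0 <= k < N.+1 | k != l)
   ('C(N, k)%:R * (-1) ^+ k / (l%:R - k%:R)) *: (u ^+ k - u ^+ l).
have DB p q : D (p - q) = D p - D q.
  by rewrite /D derivB mulrBr scalerBr; ring.
have DZ a p : D (a *: p) = a *: D p.
  by rewrite /D derivZ scalerDr -scalerAr !scalerA [a * _]mulrC.
have Dsum I (r : seq I) (B : pred I) F :
    D (\sum_(i <- r | B i) F i) = \sum_(i <- r | B i) D (F i).
  by rewrite /D raddf_sum mulr_sumr scaler_sumr -big_split.
(* Powers of [u] are eigenvectors of [D] with eigenvalue l - k: [D] cancels the denominators in [P]
   and kills [u ^+ l]. *)
have Du k : D (u ^+ k) = (l%:R - k%:R) *: u ^+ k.
  rewrite /D deriv_exp (_ : u^`() = -1);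
    last by rewrite derivB derivX -polyC1 derivC sub0r.
  case: k => [|k]; first by rewrite mulr0n mulr0 add0r subr0.
  rewrite /= mulrnAr mulrCA -exprS mulN1r scalerBl addrC.
  by rewrite !scaler_nat mulNrn.
have DP : D P = 'X^N - ('C(N, l)%:R * (-1) ^+ l) *: u ^+ l.
  rewrite /P Dsum.
  transitivity (\sum_(0 <= k < N.+1 | k != l) ('C(N, k)%:R * (-1) ^+ k) *: u ^+ k).
    apply: eq_bigr => k kl; rewrite DZ DB !Du subrr scale0r subr0 scalerA.
    by rewrite divfK // subr_eq0 eqr_nat eq_sym.
  (* What remains is the binomial expansion of X^N = (1-u)^N without its term [k = l]. *)
  apply/eqP; rewrite eq_sym subr_eq addrC; apply/eqP.
  rewrite (_ : 'X = 1 - u); last by rewrite /u subKr.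
  clearbody u; rewrite exprBn.
  rewrite big_mkord [LHS](bigD1 (Ordinal (lN : (l < N.+1)%N))) //=.
  have term i : (-1) ^+ i * 1 ^+ (N - i) * u ^+ i *+ 'C(N, i) =
      ('C(N, i)%:R * (-1) ^+ i) *: u ^+ i.
    by rewrite expr1n mulr1 -scalerA scaler_nat -signr_odd mulr_sign
      -[in RHS]signr_odd scaler_sign.
  by rewrite term; congr (_ + _); apply: eq_bigr => i _; rewrite term.
(* Below degree [N] this is the recurrence [powlog_coefS]; above [N] both sides vanish. *)
have DQ : D Q = D P.
  rewrite DP; apply/polyP => n; rewrite /D coef_powlog_ode.
  rewrite coefB !coefZ coefXn coef_exp_1subX !coef_poly.
  have := powlog_coefS R l n; set s := (-1) ^+ l; rewrite exprS -/s.
  case: (ltngtP n N) => nN rec.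
  - rewrite !ltnS nN (ltnW nN) sub0r.
    transitivity (- s * 'C(N, l)%:R * ((-1) ^+ n * 'C(l, n)%:R)); last by ring.
    by rewrite -rec; ring.
  - rewrite !ltnS [(n <= N)%N]leqNgt nN ltnNge (ltnW nN) /=.
    by rewrite (bin_small (leq_ltn_trans lN nN)); ring.
  (* At degree [N] truncation removes the coefficient of degree N + 1, leaving (l-N) times the last
     one: zero if [l = N], otherwise explicit by [powlog_coef_gt]. *)
  - have s2 : s * s = 1 by rewrite /s -exprD addnn -signr_odd odd_double.
    rewrite nN !ltnS leqnn ltnn mulr0 mulr0 add0r.
    move: lN; rewrite leq_eqVlt => /orP[/eqP lN|lN].
      by rewrite -lN subrr mul0r binn -/s mul1r mulr1 s2 subrr.
    rewrite (bin_small lN) !mulr0 subr0 powlog_coef_gt // -/s.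
    have [k Nk] : exists k, N = (k + l).+1 by exists (N - l.+1)%N; lia.
    have -> : (N - l = k.+1)%N by lia.
    rewrite pochhammer_nat (mul_bin_down (k + l).+1 l) -Nk.
    have -> : (N - l = k.+1)%N by lia.
    have -> : l%:R - N%:R = - k.+1%:R :> R.
      by rewrite Nk -addSn natrD; ring.
    have l0 : l`!%:R != 0 :> R by rewrite pnatr_eq0 -lt0n fact_gt0.
    have C0 : 'C(N, l)%:R != 0 :> R by rewrite pnatr_eq0 -lt0n bin_gt0 ltnW.
    have k0 : k.+1%:R != 0 :> R by rewrite pnatr_eq0.
    rewrite !natrM -[RHS]s2.
    move: (k.+1%:R : R) k0 => k' k0.
    by field; rewrite k0 C0 l0.
have : Q - P = 0.
  apply: (@powlog_ode_eq0 _ l%:R); first by rewrite -/u -/(D _) DB DQ subrr.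
  rewrite coefB coefZ coef_poly /= [powlog_coef _ _ _]big_nil mulr0 sub0r.
  rewrite coef_sum big1 ?oppr0 // => k _.
  by rewrite coefZ coefB !coef_exp_1subX !bin0 subrr mulr0.
move/eqP; rewrite subr_eq0 => /eqP /(congr1 (fun p : {poly R} => p.[x])).
rewrite /= hornerZ horner_poly horner_sum big_mkord => ->.
by apply: eq_bigr => k _; rewrite hornerZ hornerD hornerN
  !horner_exp hornerD hornerN hornerX hornerC.
Qed.

(** * The two closed forms *)

Theorem theorem3p1 (R : realType) (m l : nat) (hm : (1 <= m)%N) (x : R)
    (hx0 : 0 < `|x|) (hx1 : `|x| < 1) :
  hyp2F1 1 m%:R (m + l + 1)%:R x =
    pochhammer m%:R l.+1 / x ^+ (m + l) * ((-1) ^+ l.+1 / l`!%:R) *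
      (1 - x) ^+ l * ln (1 - x)
    + (m + l)%:R / x ^+ (m + l) *
      \sum_(0 <= i < m + l | (i != m - 1)%N)
        ('C(m + l - 1, i)%:R *
         ((-1) ^+ (m + l - 1 - i) / (i%:R - m%:R + 1)) *
         ((1 - x) ^+ (m + l - 1 - i) - (1 - x) ^+ l))
  /\
  hyp2F1 1 m%:R (m + l + 1)%:R x =
    pochhammer m%:R l.+1 / x ^+ (m + l) * ((-1) ^+ l.+1 / l`!%:R) *
      (1 - x) ^+ l * ln (1 - x)
    + pochhammer m%:R l.+1 / x ^+ (m + l) *
      ((-1) ^+ l.+1 / l`!%:R *
         (\sum_(1 <= j < l.+1)
            x ^+ j * \sum_(0 <= i < j) ((-1) ^+ i / (j%:R - i%:R) * 'C(l, i)%:R))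
       - \sum_(0 <= i < m - 1) x ^+ (l + i + 1) / pochhammer (i + 1)%:R l.+1).
Proof.
have x0 : x != 0 by rewrite -normr_gt0.
have xm0 : x ^+ (m + l) != 0 by rewrite expf_neq0.
have fact0 : l`!%:R != 0 :> R by rewrite pnatr_eq0 -lt0n fact_gt0.
rewrite hyp2F1_powlog //; split; rewrite mulrDr mulrA; congr (_ + _).
  case: m hm xm0 => [//|n] _ xm0; rewrite addSn subn1 /= pochhammer_nat.
  have -> : ((n + l).+1 - 1 = n + l)%N by lia.
  (* With [m = n.+1], the reversal [k = n + l - i] sends the excluded index [n] to [l], matching
     [sum_powlog_coef] at [N = n + l]. *)
  have -> : \sum_(0 <= i < (n + l).+1 | i != n)
      ('C(n + l, i)%:R * ((-1) ^+ (n + l - i) / (i%:R - n.+1%:R + 1)) *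
       ((1 - x) ^+ (n + l - i) - (1 - x) ^+ l)) =
      \sum_(0 <= k < (n + l).+1 | k != l)
      'C(n + l, k)%:R * (-1) ^+ k / (l%:R - k%:R) * ((1 - x) ^+ k - (1 - x) ^+ l).
    rewrite big_nat_rev /= big_nat_cond [RHS]big_nat_cond.
    apply: eq_big => [k|k /andP[/andP[_ kN] _]].
      by apply: andb_id2l => /andP[_ kN]; congr (~~ _); apply/eqP/eqP; lia.
    rewrite add0n subSS subKn // bin_sub // natrB // -natr1 natrD.
    by rewrite mulrA; congr (_ / _ * _); ring.
  rewrite -sum_powlog_coef ?leq_addl // !natrM.
  move: xm0; rewrite addSn => xm0.
  by field; rewrite fact0 xm0.
rewrite -mulrA; congr (_ * _).
(* Degrees up to [l] give the double sum, whose degree 0 coefficient is an empty sum; the [m - 1]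
   higher ones are explicit by [powlog_coef_gt]. *)
have -> : (m + l = l.+1 + (m - 1))%N by lia.
rewrite (big_cat_nat _ (n := l.+1)) ?leq_addr //= mulrDr; congr (_ + _).
  congr (_ * _); rewrite big_nat_recl // /powlog_coef big_nil mul0r add0r.
  by rewrite big_add1 /=; apply: eq_bigr => i _; rewrite mulrC.
rewrite [X in _ * X = _](big_addn 0 _ l.+1) addKn mulr_sumr -sumrN.
apply: eq_bigr => i _.
rewrite powlog_coef_gt; last by lia.
rewrite (_ : i + l.+1 - l = i + 1)%N; last by lia.
rewrite (_ : l + i + 1 = i + l.+1)%N; last by lia.
have s2 : (-1) ^+ l * (-1) ^+ l = 1 :> R by rewrite -exprD addnn -signr_odd odd_double.
have P0 : pochhammer (i + 1)%:R l.+1 != 0 :> R.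
  by rewrite gt_eqF // pochhammer_gt0 // ltr0n addn1.
rewrite exprS -[RHS]mulr1 -[X in _ = _ * X]s2.
by field; rewrite P0 fact0.
Qed.
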